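(* Let $\phi$ be an LTL formula in the class on which $ofp$ is defined (see context). If there exists a position $i\ge0$ such that the propositional formula $ofp(\phi)\!\downarrow_i$ is unsatisfiable, then $\phi$ is unsatisfiable, i.e. no $\xi\in(2^{AP})^\omega$ satisfies $\xi\models\phi$.
   Context: Let $AP$ be a finite set of atomic propositions; a literal is $a$ or $\neg a$ with $a\in AP$. Consider LTL formulas generated by $\phi::=p\mid\phi\wedge\phi\mid\phi\vee\phi\mid X\phi\mid\phi U\phi\mid\phi R\phi\mid G\phi$, where $p$ is a literal. The left arguments of $U$ and $R$ may be arbitrary LTL formulas (including $\mathit{tt},\mathit{ff}$; e.g. $F\psi=\mathit{tt}U\psi$). Semantics over $\xi=\xi(0)\xi(1)\cdots\in(2^{AP})^\omega$ with suffixes $\xi_k$: - $\xi\models a$ iff $a\in\xi(0)$, and $\xi\models\neg a$ iff $a\notin\xi(0)$; - $\xi\models X\phi$ iff $\xi_1\models\phi$; - $\xi\models\phi_1U\phi_2$ iff $\exists i\ge0$ with $\xi_i\models\phi_2$ and $\xi_j\models\phi_1$ for all $j<i$; - $\xi\models\phi_1R\phi_2$ iff either $\xi_i\models\phi_2$ for all $i$, or $\exists i$ with $\xi_i\models\phi_1\wedge\phi_2$ and $\xi_j\models\phi_2$ for all $j<i$; - $\xi\models G\phi$ iff $\xi_i\models\phi$ for all $i$. A positional literal is a triple $l=\langle p,s,d\rangle$ with $l.prop=p$ a literal, $l.start=s\in\mathbb{N}\cup\{\star\}$ and $l.duration=d\in\{\mathrm{cur},\inf,\ge\}$. The formula $ofp(\phi)$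 is a positive Boolean combination of positional literals; $[ofp(\phi)]$ is the set of positional literals occurring in it. It is defined recursively: - $ofp(p)=\langle p,0,\mathrm{cur}\rangle$; - $ofp(\phi_1\wedge\phi_2)=ofp(\phi_1)\wedge ofp(\phi_2)$; - $ofp(\phi_1\vee\phi_2)=ofp(\phi_1)\vee ofp(\phi_2)$ if all positional literals in $[ofp(\phi_1)]\cup[ofp(\phi_2)]$ have the same start (where $\star$ equals $\star$). Otherwise $ofp(\phi_1\vee\phi_2)=ofp(\phi_1)'\vee ofp(\phi_2)'$, where $'$ replaces every $\langle p,s,d\rangle$ by $\langle p,\star,\mathrm{cur}\rangle$; - $ofp(X\psi)=Pos(ofp(\psi),X)$; - $ofp(\phi_1U\phi_2)=Pos(ofp(\phi_2),U)$; - $ofp(\phi_1R\phi_2)=Pos(ofp(\phi_2),R)$; - $ofp(G\psi)=Pos(ofp(\psi),G)$. $Pos(t,\mathit{type})$ replaces each positional literal of $t$, keeping the Boolean structure, according to the following rules, where $i\in\mathbb{N}$: - $\langle p,i,\mathrm{cur}\rangle$ becomes $\langle p,i+1,\mathrm{cur}\rangle$ under X, $\langle p,\star,\mathrm{cur}\rangle$ under U, $\langle p,i,\mathrm{cur}\rangle$ under R, and $\langle p,i,\ge\rangle$ under G; - $\langle p,\star,\mathrm{cur}\rangle$ stays $\langle p,\star,\mathrm{cur}\rangle$ under X, U and R, and becomes $\langle p,\star,\inf\rangle$ under G; - $\langle p,i,\ge\rangle$ becomes $\langle p,i+1,\ge\rangle$ under X, $\langle p,\star,\ge\rangle$ under U,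 and stays $\langle p,i,\ge\rangle$ under R and G; - $\langle p,\star,\ge\rangle$ is unchanged under X, U, R and G; - $\langle p,i,\inf\rangle$ becomes $\langle p,i+1,\inf\rangle$ under X, $\langle p,\star,\inf\rangle$ under U, and stays $\langle p,i,\inf\rangle$ under R and G; - $\langle p,\star,\inf\rangle$ is unchanged under X, U, R and G. Projection $ofp(\phi)\!\downarrow_i$, for $i\in\mathbb{N}$, is the propositional formula obtained from $ofp(\phi)$ by the following replacement: - each positional literal $l$ is replaced by $l.prop$ if $l.start=i$, or if $l.start\in\mathbb{N}$, $l.start<i$ and $l.duration=\ge$; - otherwise $l$ is replaced by $\mathit{tt}$; - $\wedge$ and $\vee$ are preserved. *)

(* Defs.v *)
From mathcomp Require Import all_boot.

Set Implicit Arguments.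
Unset Strict Implicit.
Unset Printing Implicit Defensive.

Inductive literal (AP : finType) : Type :=
| Pos_lit of AP
| Neg_lit of AP.

Definition lit_holds (AP : finType) (A : {set AP}) (p : literal AP) : bool :=
  match p with
  | Pos_lit a => a \in A
  | Neg_lit a => a \notin A
  end.

(* Arbitrary LTL formulas, as allowed to the left of U and R. *)
Inductive ltl (AP : finType) : Type :=
| LTrue
| LFalse
| LLit of literal AP
| LNot of ltl AP
| LAnd of ltl AP & ltl AP
| LOr of ltl AP & ltl AP
| LX of ltl AP
| LU of ltl AP & ltl AP
| LR of ltl AP & ltl AP
| LG of ltl AP.

Definition word (AP : finType) : Type := nat -> {set AP}.

Definition suffix (AP : finType) (xi : word AP) (k : nat) : word AP :=
  fun n => xi (k + n).

Fixpoint ltl_sat (AP : finType) (xi : word AP) (phi : ltl AP) : Prop :=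
  match phi with
  | LTrue => True
  | LFalse => False
  | LLit p => lit_holds (xi 0) p
  | LNot f => ~ ltl_sat xi f
  | LAnd f g => ltl_sat xi f /\ ltl_sat xi g
  | LOr f g => ltl_sat xi f \/ ltl_sat xi g
  | LX f => ltl_sat (suffix xi 1) f
  | LU f g =>
      exists i, ltl_sat (suffix xi i) g /\
        forall j, j < i -> ltl_sat (suffix xi j) f
  | LR f g =>
      (forall i, ltl_sat (suffix xi i) g) \/
      exists i, (ltl_sat (suffix xi i) f /\ ltl_sat (suffix xi i) g) /\
        forall j, j < i -> ltl_sat (suffix xi j) g
  | LG f => forall i, ltl_sat (suffix xi i) f
  end.

(* The class of LTL formulas on which ofp is defined: tt, ff and negations of
   compound formulas can occur only inside left arguments of U and R. *)
Inductive ltl_ofp (AP : finType) : Type :=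
| FLit of literal AP
| FAnd of ltl_ofp AP & ltl_ofp AP
| FOr of ltl_ofp AP & ltl_ofp AP
| FX of ltl_ofp AP
| FU of ltl AP & ltl_ofp AP
| FR of ltl AP & ltl_ofp AP
| FG of ltl_ofp AP.

Fixpoint ltl_of (AP : finType) (phi : ltl_ofp AP) : ltl AP :=
  match phi with
  | FLit p => LLit p
  | FAnd f g => LAnd (ltl_of f) (ltl_of g)
  | FOr f g => LOr (ltl_of f) (ltl_of g)
  | FX f => LX (ltl_of f)
  | FU f g => LU f (ltl_of g)
  | FR f g => LR f (ltl_of g)
  | FG f => LG (ltl_of f)
  end.

Inductive duration : Type := Cur | Inf | Ge.

(* A start of None stands for the unknown position, written as a star. *)
Record poslit (AP : finType) : Type := PosLit {
  prop : literal AP;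
  start : option nat;
  dur : duration
}.

(* Positive Boolean combinations of positional literals. *)
Inductive pbc (AP : finType) : Type :=
| BLit of poslit AP
| BAnd of pbc AP & pbc AP
| BOr of pbc AP & pbc AP.

Fixpoint pbc_map (AP : finType) (h : poslit AP -> poslit AP) (t : pbc AP) :
    pbc AP :=
  match t with
  | BLit l => BLit (h l)
  | BAnd t1 t2 => BAnd (pbc_map h t1) (pbc_map h t2)
  | BOr t1 t2 => BOr (pbc_map h t1) (pbc_map h t2)
  end.

Fixpoint pbc_lits (AP : finType) (t : pbc AP) : seq (poslit AP) :=
  match t with
  | BLit l => [:: l]
  | BAnd t1 t2 => pbc_lits t1 ++ pbc_lits t2
  | BOr t1 t2 => pbc_lits t1 ++ pbc_lits t2
  end.

Definition same_start (AP : finType) (s : seq (poslit AP)) : bool :=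
  constant (map (@start AP) s).

Definition forget_position (AP : finType) (l : poslit AP) : poslit AP :=
  PosLit (prop l) None Cur.

Inductive temp_op : Type := OpX | OpU | OpR | OpG.

Definition pos_lit (AP : finType) (l : poslit AP) (o : temp_op) : poslit AP :=
  let: PosLit p s d := l in
  match s, d, o with
  | Some i, _, OpX => PosLit p (Some i.+1) d
  | Some _, _, OpU => PosLit p None d
  | Some _, _, OpR => l
  | Some i, Cur, OpG => PosLit p (Some i) Ge
  | Some _, _, OpG => l
  | None, Cur, OpG => PosLit p None Inf
  | None, _, _ => l
  end.

Definition Pos (AP : finType) (t : pbc AP) (o : temp_op) : pbc AP :=
  pbc_map (fun l => pos_lit l o) t.

Fixpoint ofp (AP : finType) (phi : ltl_ofp AP) : pbc AP :=
  match phi with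
  | FLit p => BLit (PosLit p (Some 0) Cur)
  | FAnd f g => BAnd (ofp f) (ofp g)
  | FOr f g =>
      if same_start (pbc_lits (ofp f) ++ pbc_lits (ofp g))
      then BOr (ofp f) (ofp g)
      else BOr (pbc_map (@forget_position AP) (ofp f))
               (pbc_map (@forget_position AP) (ofp g))
  | FX f => Pos (ofp f) OpX
  | FU _ g => Pos (ofp g) OpU
  | FR _ g => Pos (ofp g) OpR
  | FG f => Pos (ofp f) OpG
  end.

Inductive pform (AP : finType) : Type :=
| PTrue
| PLit of literal AP
| PAnd of pform AP & pform AP
| POr of pform AP & pform AP.

Fixpoint pform_holds (AP : finType) (A : {set AP}) (f : pform AP) : bool :=
  match f with
  | PTrue => true
  | PLit p => lit_holds A p
  | PAnd f1 f2 => pform_holds A f1 && pform_holds A f2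
  | POr f1 f2 => pform_holds A f1 || pform_holds A f2
  end.

Definition pform_satisfiable (AP : finType) (f : pform AP) : Prop :=
  exists A : {set AP}, pform_holds A f.

Definition proj_lit (AP : finType) (i : nat) (l : poslit AP) : pform AP :=
  match start l, dur l with
  | Some s, Ge => if s <= i then PLit (prop l) else PTrue AP
  | Some s, _ => if s == i then PLit (prop l) else PTrue AP
  | None, _ => PTrue AP
  end.

Fixpoint proj (AP : finType) (t : pbc AP) (i : nat) : pform AP :=
  match t with
  | BLit l => proj_lit i l
  | BAnd t1 t2 => PAnd (proj t1 i) (proj t2 i)
  | BOr t1 t2 => POr (proj t1 i) (proj t2 i)
  end.

Definition ltl_satisfiable (AP : finType) (phi : ltl AP) : Prop :=
  exists xi : word AP, ltl_sat xi phi.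

(* Main.v *)
Require Import Defs.
From mathcomp Require Import all_boot.

(** If [xi] satisfies [phi], then for every [i] the letter [xi i] satisfies the
    projection of [ofp phi] at [i]. The critical operator is G: a disjunction
    holding at all suffixes must yield a disjunction at every single position.
    This works because below each disjunction of [ofp phi] all literals share
    one start [s]: for a number [s <= i], the projection at [s] with respect to
    the suffix from [i - s] speaks about position [i] and has all those
    literals switched on; for a star, or for [i < s], the projection is
    trivially true. *)

Set Implicit Arguments.
Unset Strict Implicit.
Unset Printing Implicit Defensive.

Section Projection.
Variable AP : finType.
Implicit Types (t : pbc AP) (l : poslit AP) (h : poslit AP -> poslit AP).
Implicit Types (A : {set AP}) (xi : word AP) (phi : ltl_ofp AP).

Definition starts_at (s : option nat) l : bool := start l == s.

Lemma same_startP (r : seq (poslit AP)) :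
  reflect (exists s, all (starts_at s) r) (same_start r).
Proof.
rewrite /same_start; case: r => [|l r] /=; first by left; exists None.
rewrite all_map; apply: (iffP idP) => [Hr | [s /andP[/eqP -> Hr]] //].
by exists (start l); rewrite /starts_at eqxx.
Qed.

(** The invariant that the side condition of [ofp] on disjunctions is designed to establish; it must
    survive every later [Pos] to be available under G. *)
Fixpoint or_same_start t : bool :=
  match t with
  | BLit _ => true
  | BAnd t1 t2 => or_same_start t1 && or_same_start t2
  | BOr t1 t2 => [&& same_start (pbc_lits t1 ++ pbc_lits t2),
                     or_same_start t1 & or_same_start t2]
  end.

Lemma pbc_lits_map h t : pbc_lits (pbc_map h t) = map h (pbc_lits t).
Proof. by elim: t => //= t1 -> t2 ->; rewrite map_cat. Qed.

Lemma same_start_map h (f : option nat -> option nat) (r : seq (poslit AP)) :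
  (forall l, start (h l) = f (start l)) -> same_start r -> same_start (map h r).
Proof.
move=> Hh /same_startP[s Hs]; apply/same_startP; exists (f s).
rewrite all_map; apply: sub_all Hs => l /eqP Hl.
by rewrite /= /starts_at Hh Hl.
Qed.

Lemma or_same_start_map h (f : option nat -> option nat) t :
  (forall l, start (h l) = f (start l)) ->
  or_same_start t -> or_same_start (pbc_map h t).
Proof.
move=> Hh; elim: t => //= t1 IH1 t2 IH2.
  by case/andP=> /IH1-> /IH2->.
case/and3P=> H /IH1-> /IH2->.
by rewrite !pbc_lits_map -map_cat (same_start_map Hh H).
Qed.

Lemma or_same_start_forget t : or_same_start (pbc_map (@forget_position AP) t).
Proof.
elim: t => //= t1 -> t2 ->; rewrite ?andbT //.
rewrite !pbc_lits_map -map_cat; apply/same_startP; exists None.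
by rewrite all_map all_predT.
Qed.

(** The start computed by [pos_lit] depends on the old start and the operator only, never on the
    duration, so equal starts stay equal. *)
Lemma or_same_start_Pos t o : or_same_start t -> or_same_start (Pos t o).
Proof.
apply: (@or_same_start_map _ (fun s =>
  match s, o with
  | Some i, OpX => Some i.+1
  | _, OpU => None
  | _, _ => s
  end)).
by case=> p [i|] [] /=; case: o.
Qed.

Lemma or_same_start_ofp phi : or_same_start (ofp phi).
Proof.
elim: phi => //= [f -> g -> //|f IHf g IHg|f IH|_ f IH|_ f IH|f IH];
  try exact: or_same_start_Pos.
case: ifP => /= H; first by rewrite H IHf IHg.
exact: (or_same_start_forget (BOr (ofp f) (ofp g))).
Qed.

(** Projections are monotone in their literals, so an implication between literals lifts to the
    whole formula. The positions [i] and [j] differ for X and G, and [P] records a common start. *)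
Lemma proj_map_mono (P : pred (poslit AP)) h A i j t :
    (forall l, P l -> pform_holds A (proj_lit i l) ->
       pform_holds A (proj_lit j (h l))) ->
  all P (pbc_lits t) ->
  pform_holds A (proj t i) -> pform_holds A (proj (pbc_map h t) j).
Proof.
move=> HP; elim: t => /= [l|t1 IH1 t2 IH2|t1 IH1 t2 IH2].
- by rewrite andbT; apply: HP.
- by rewrite all_cat => /andP[/IH1 H1 /IH2 H2] /andP[/H1-> /H2->].
- rewrite all_cat => /andP[/IH1 H1 /IH2 H2] /orP[/H1-> // | /H2->].
  by rewrite orbT.
Qed.

Lemma proj_map_true (P : pred (poslit AP)) h A j t :
    (forall l, P l -> pform_holds A (proj_lit j (h l))) ->
  all P (pbc_lits t) -> pform_holds A (proj (pbc_map h t) j).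
Proof.
move=> HP; elim: t => /= [l|t1 IH1 t2 IH2|t1 IH1 t2 IH2].
- by rewrite andbT; apply: HP.
- by rewrite all_cat => /andP[/IH1-> /IH2->].
- by rewrite all_cat => /andP[/IH1->].
Qed.

Lemma proj_forget A i t :
  pform_holds A (proj (pbc_map (@forget_position AP) t) i).
Proof. by apply: (@proj_map_true predT) => //; rewrite all_predT. Qed.

Lemma proj_Pos_U A i t : pform_holds A (proj (Pos t OpU) i).
Proof.
apply: (@proj_map_true predT); last by rewrite all_predT.
by case=> p [s|] [].
Qed.

Lemma proj_Pos_R A i t :
  pform_holds A (proj t i) -> pform_holds A (proj (Pos t OpR) i).
Proof.
apply: (@proj_map_mono predT); last by rewrite all_predT.
by case=> p [s|] [].
Qed.

(** After X every numeric start is a successor, so no literal is active at position 0. *)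
Lemma proj_Pos_X0 A t : pform_holds A (proj (Pos t OpX) 0).
Proof.
apply: (@proj_map_true predT); last by rewrite all_predT.
by case=> p [s|] [].
Qed.

Lemma proj_Pos_XS A i t :
  pform_holds A (proj t i) -> pform_holds A (proj (Pos t OpX) i.+1).
Proof.
apply: (@proj_map_mono predT); last by rewrite all_predT.
by case=> p [s|] [].
Qed.

Lemma proj_Pos_G_same_start s xi t :
    all (starts_at s) (pbc_lits t) ->
    (forall k j, pform_holds (Defs.suffix xi k j) (proj t j)) ->
  forall i, pform_holds (xi i) (proj (Pos t OpG) i).
Proof.
move=> Hs Ht i; case: s Hs => [s|] Hs; last first.
  by apply: proj_map_true Hs => -[p s []] /eqP /= ->.
case: (leqP s i) => [le_si | lt_is].
  have := Ht (i - s) s; rewrite /Defs.suffix subnK //.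
  (* At [s] each literal projects to its proposition whatever its duration; under G it projects at
     [i] to that proposition or, for [Inf] with [s] other than [i], to tt. *)
  apply: proj_map_mono Hs => -[p s' d] /eqP /= ->.
  by case: d; rewrite /proj_lit /= ?leqnn ?eqxx ?le_si //; case: ifP.
apply: proj_map_true Hs => -[p s' d] /eqP /= ->.
by case: d; rewrite /proj_lit /= ?(leqNgt s) ?lt_is ?(gtn_eqF lt_is).
Qed.

Lemma proj_Pos_G xi t :
    or_same_start t ->
    (forall k j, pform_holds (Defs.suffix xi k j) (proj t j)) ->
  forall i, pform_holds (xi i) (proj (Pos t OpG) i).
Proof.
elim: t => [l _|t1 IH1 t2 IH2|t1 _ t2 _].
- by apply: (@proj_Pos_G_same_start (start l)); rewrite /= /starts_at eqxx.
- case/andP=> H1 H2 Ht i; apply/andP.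
  by split; [apply: IH1 | apply: IH2] => // k j; case/andP: (Ht k j).
(* Induction fails here, since the true disjunct may vary with [k] and [j]; the common start treats
   the disjunction as a whole. *)
- by case/and3P=> /same_startP[s Hs] _ _; exact: (@proj_Pos_G_same_start s xi (BOr t1 t2)).
Qed.

Lemma ltl_sat_proj phi xi i :
  ltl_sat xi (ltl_of phi) -> pform_holds (xi i) (proj (ofp phi) i).
Proof.
elim: phi xi i => /= [p|f IHf g IHg|f IHf g IHg|f IH|f g IH|f g IH|f IH] xi i.
- by case: i.
- by case=> /IHf-> /IHg->.
- case: ifP => _ /= Hfg; last by rewrite proj_forget.
  by case: Hfg => [/IHf-> // | /IHg->]; rewrite orbT.
- by case: i => [|i] H; [apply: proj_Pos_X0 | apply/proj_Pos_XS/(IH _ i H)].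
- by move=> _; apply: proj_Pos_U.
(* Whether or not a release occurs, and even if it occurs at 0, the right argument holds at 0. *)
- move=> Hfg; apply/proj_Pos_R/(IH (Defs.suffix xi 0)).
  by case: Hfg => [|[[|k] [[_ Hk] Hlt]]] //; apply: Hlt.
- move=> H; apply: proj_Pos_G; first exact: or_same_start_ofp.
  by move=> k j; apply: IH.
Qed.

End Projection.

Theorem theorem5 (AP : finType) (phi : ltl_ofp AP) :
  (exists i : nat, ~ pform_satisfiable (proj (ofp phi) i)) ->
  ~ ltl_satisfiable (ltl_of phi).
Proof.
by case=> i Hi [xi Hxi]; apply: Hi; exists (xi i); apply: ltl_sat_proj.
Qed.
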